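(* Let $\mathcal{L}$ be the uncertainty set of the LTV system, and let $\mathcal{P}=\mathrm{Conv}\{\mathcal{V}\}$, $\mathcal{V}=\{(A_i,B_i): i=1,\dots,m\}$, be a convex polytope with $\mathcal{L}\subseteq\mathcal{P}$ (see context). Let $0<k_m<k_M$. Consider the optimization problem $$\begin{array}{ll}\text{minimize} & s\\ \text{subject to} & (A_i-B_iK_iC)^TP+P(A_i-B_iK_iC)\preceq sI\quad \forall (A_i,B_i)\in\mathcal{V},\\ & k_m\le K_i\le k_M,\quad i=1,2,\dots,m,\\ & P\succ 0,\end{array}$$ with design variables $s\in\mathbb{R}$, $P\in\mathbb{R}^{N\times N}$ and $K_i\in\mathbb{R}$, $i=1,\dots,m$. If the optimal value of this problem is negative, then condition [C1] holds, i.e. there exist $P\succ0$ and $\sigma>0$ such that for every $(A,B)\in\mathcal{L}$ there exists a gain $K_{AB}\in[k_m,k_M]$ with $$(A-BK_{AB}C)^TP+P(A-BK_{AB}C)\preceq -\sigma I .$$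
   Context: System. The LTV system is $\dot x=A(t)x+B(t)u$, $y=Cx=x_1$, with $x\in\mathbb{R}^N$, $u,y\in\mathbb{R}$. $A(t)\in\mathbb{R}^{N\times N}$ is in companion form: its first $N-1$ rows have $1$ on the superdiagonal and $0$ elsewhere, and its last row is $[a_1(t),\dots,a_N(t)]$; $B(t)=[0,\dots,0,b(t)]^T\in\mathbb{R}^{N\times1}$; $C=[1,0,\dots,0]\in\mathbb{R}^{1\times N}$. A pair $(A,B)$ of this form is identified with the vector $[a_1,\dots,a_N,b]\in\mathbb{R}^{N+1}$. Uncertainty set. $(A(t),B(t))$ belongs for all $t$ to a known bounded connected set $\mathcal{L}$, which is the image $F(\mathcal{S})$ of a hyper-rectangle $\mathcal{S}\subset\mathbb{R}^p$ of physical parameters under the map $F$ giving $(A,B)$ as a function of the parameters. Standing assumption on sign: $b\in[b_l,b_u]$ for the $b$-entry of the elements of $\mathcal{L}$, where $b_l\le b_u$ and either $b_l>0$ or $b_u<0$. Polytope. $\mathcal{V}=\{(A_i,B_i):i=1,\dots,m\}$ is the set of $m$ vertices (pairs of the same form, with $b$-entries $b_i$) of a convex polytope $\mathcal{P}=\mathrm{Conv}\{\mathcal{V}\}$ (the convex hull of $\mathcal{V}$) such that $\mathcal{L}\subseteq\mathcal{P}$. Notation. For square matrices, $X\preceq Y$ means $Y-X$ is positive semi-definite and $P\succ0$ means $P$ is positive definite (a square matrix $M$ is positive definite if $x^TMx>0$ for all $x\ne0$, and positive semi-definite if $x^TMx\ge0$ for all $x$). $I$ is the identity matrix.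
   Formalization: The formal theorem additionally assumes that the b-entries b_i of all vertices have the same sign as [b_l,b_u] (zero allowed); without this the claim fails, e.g. N=1, k_m=1, k_M=2, V={[11/2,3],[-3/2,-1]}, L={[2,1]}. *)

(* Defs.v *)
From HB Require Import structures.
From mathcomp Require Import all_boot all_order all_algebra.
From mathcomp Require Import all_classical all_reals all_analysis.
Set Implicit Arguments.
Unset Strict Implicit.
Unset Printing Implicit Defensive.
Import Order.TTheory GRing.Theory Num.Theory.
Import numFieldNormedType.Exports.
Local Open Scope classical_set_scope.
Local Open Scope ring_scope.

Section definiteness.
Context {R : realType} {n : nat}.
Implicit Types M X Y : 'M[R]_n.

(* Neither notion presupposes that the matrix is symmetric. *)
Definition posdef M : Prop :=
  forall x : 'cV[R]_n, x != 0 -> 0 < (x^T *m M *m x) 0 0.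

Definition possemidef M : Prop :=
  forall x : 'cV[R]_n, 0 <= (x^T *m M *m x) 0 0.

Definition mxpreceq X Y : Prop := possemidef (Y - X).

End definiteness.

Section companion_form.
Context {R : realType} {N : nat}.
Implicit Types (v : 'rV[R]_N.+1) (P : 'M[R]_N).

(* A pair (A, B) in companion form is identified with the row vector
   v = [a_1, ..., a_N, b] of length N + 1. *)
Definition acoef v (j : 'I_N) : R := v 0 (widen_ord (leqnSn N) j).

Definition bcoef v : R := v 0 ord_max.

(* Indices start at 0, so the last row is the one with i.+1 = N. *)
Definition Amx v : 'M[R]_N :=
  \matrix_(i, j) if i.+1 == N then acoef v j else (j == i.+1 :> nat)%:R.

Definition Bmx v : 'cV[R]_N := \col_i if i.+1 == N then bcoef v else 0.

Definition Cmx : 'rV[R]_N := \row_j (j == 0 :> nat)%:R.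

Definition closed_loop v (K : R) : 'M[R]_N := Amx v - Bmx v *m K%:M *m Cmx.

Definition lyapunov_form v (K : R) P : 'M[R]_N :=
  (closed_loop v K)^T *m P + P *m closed_loop v K.

End companion_form.

Section polytope.
Context {R : realType} {n m : nat}.
Implicit Types V : 'I_m -> 'rV[R]_n.

Definition conv_hull V : set 'rV[R]_n :=
  [set x | exists w : 'I_m -> R,
    [/\ forall i, 0 <= w i, \sum_i w i = 1 & x = \sum_i w i *: V i]].

Definition extreme_point (S : set 'rV[R]_n) (z : 'rV[R]_n) : Prop :=
  S z /\ forall x y (t : R), S x -> S y -> 0 < t -> t < 1 ->
    z = t *: x + (1 - t) *: y -> x = z /\ y = z.

(* The V i are pairwise distinct and each is a vertex of their convex hull. *)
Definition polytope_vertices V : Prop :=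
  injective V /\ forall i, extreme_point (conv_hull V) (V i).

End polytope.

Definition hyper_rectangle {R : realType} {p : nat} (lo hi : 'rV[R]_p) :
    set 'rV[R]_p :=
  [set q | forall j, lo 0 j <= q 0 j <= hi 0 j].

(* Nonzero interval of one sign containing the b-entries of the elements of L. *)
Definition b_entries_in {R : realType} {N : nat} (L : set 'rV[R]_N.+1)
    (bl bu : R) : Prop :=
  [/\ bl <= bu, 0 < bl \/ bu < 0 & forall v, L v -> bl <= bcoef v <= bu].

(* The hull of V may be larger than L, so the sign of b on L does not by itself
   control the b-entries of the vertices: these are required to have the sign
   of [bl, bu], zero being allowed.  Without it C1 can fail: take N = 1,
   km = 1, kM = 2, V = {[11/2, 3], [-3/2, -1]} and L = {[2, 1]}. *)
Definition vertex_sign {R : realType} {N m : nat} (V : 'I_m -> 'rV[R]_N.+1)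
    (bl bu : R) : Prop :=
  (0 < bl -> forall i, 0 <= bcoef (V i)) /\
  (bu < 0 -> forall i, bcoef (V i) <= 0).

Section optimization_problem.
Context {R : realType} {N m : nat}.
Variables (V : 'I_m -> 'rV[R]_N.+1) (km kM : R).

Definition feasible (s : R) (P : 'M[R]_N) (K : 'I_m -> R) : Prop :=
  [/\ forall i, mxpreceq (lyapunov_form (V i) (K i) P) s%:M,
      forall i, km <= K i <= kM
    & posdef P].

(* The infimum is taken in the extended reals: the constraints are invariant
   under scaling (s, P) by a positive factor, so a negative optimal value is
   always -oo and is not attained. *)
Definition optimal_value : \bar R :=
  ereal_inf [set s%:E | s in [set s | exists P K, feasible s P K]].

End optimization_problem.

Definition condition_C1 {R : realType} {N : nat} (L : set 'rV[R]_N.+1)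
    (km kM : R) : Prop :=
  exists (P : 'M[R]_N) (sigma : R), [/\ posdef P, 0 < sigma
    & forall v, L v -> exists K : R, km <= K <= kM /\
        mxpreceq (lyapunov_form v K P) (- sigma)%:M].

(* Main.v *)
(* Write v in L as a convex combination sum_i w_i V_i and let b, b_i be the
   b-entries of v, V_i.  The closed loop depends on the gain only through the
   product b K, so K := sum_i (w_i b_i / b) K_i makes the closed loop at (v, K)
   the w-convex combination of the closed loops at (V_i, K_i), and the Lyapunov
   inequality with a feasible s < 0 passes to it.  As b <> 0 and all b_i have
   the sign of b, the weights w_i b_i / b are again convex, which keeps K in
   [km, kM]. *)
Require Import Defs.
From HB Require Import structures.
From mathcomp Require Import all_boot all_order all_algebra.
From mathcomp Require Import all_classical all_reals all_analysis.
Import Order.TTheory GRing.Theory Num.Theory.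
Import numFieldNormedType.Exports.
Local Open Scope classical_set_scope.
Local Open Scope ring_scope.

Section convex_combination.
Context {R : realType} {N m : nat}.
Implicit Types (w : 'I_m -> R) (V : 'I_m -> 'rV[R]_N.+1).

Lemma bcoef_sum w V : bcoef (\sum_i w i *: V i) = \sum_i w i * bcoef (V i).
Proof. by rewrite /bcoef summxE; apply: eq_bigr => i _; rewrite mxE. Qed.

(** [Bmx v] lives in the last row and [Cmx] in the first column, so the feedback alters at most one
    entry, by [bcoef v * K]. *)
Lemma closed_loopE (v : 'rV[R]_N.+1) (K : R) (i j : 'I_N) :
  closed_loop v K i j =
  if i.+1 == N then acoef v j - bcoef v * K * (j == 0 :> nat)%:R
  else (j == i.+1 :> nat)%:R.
Proof.
rewrite /closed_loop mul_mx_scalar -scalemxAl !mxE big_ord1 !mxE.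
case: ifP => _; first by rewrite mulrCA mulrA.
by rewrite mul0r mulr0 subr0.
Qed.

(** The last row is linear in the coefficients of [v] and in the product of b-entry and gain; the
    other rows are constant, hence preserved by weights of sum 1. *)
Lemma closed_loop_convex w V (k : 'I_m -> R) (K : R) :
  \sum_i w i = 1 ->
  bcoef (\sum_i w i *: V i) * K = \sum_i w i * (bcoef (V i) * k i) ->
  closed_loop (\sum_i w i *: V i) K = \sum_i w i *: closed_loop (V i) (k i).
Proof.
move=> w1 bK; apply/matrixP => i j; rewrite closed_loopE summxE.
under [RHS]eq_bigr => l _ do rewrite mxE closed_loopE.
case: ifP => _; last by rewrite -mulr_suml w1 mul1r.
rewrite bK /acoef summxE mulr_suml -sumrB; apply: eq_bigr => l _.
by rewrite mxE mulrBr !mulrA.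
Qed.

(** Since [P] is common to all vertices, the form is linear in the closed loop. *)
Lemma lyapunov_form_convex w V (k : 'I_m -> R) (K : R) (P : 'M[R]_N) :
  closed_loop (\sum_i w i *: V i) K = \sum_i w i *: closed_loop (V i) (k i) ->
  lyapunov_form (\sum_i w i *: V i) K P =
  \sum_i w i *: lyapunov_form (V i) (k i) P.
Proof.
rewrite /lyapunov_form => ->; rewrite raddf_sum mulmx_suml mulmx_sumr.
rewrite -big_split; apply: eq_bigr => i _ /=.
by rewrite linearZ /= -scalemxAl -scalemxAr -scalerDr.
Qed.

Lemma mxpreceq_convex {n : nat} w (X : 'I_m -> 'M[R]_n) (Y : 'M[R]_n) :
  (forall i, 0 <= w i) -> \sum_i w i = 1 -> (forall i, mxpreceq (X i) Y) ->
  mxpreceq (\sum_i w i *: X i) Y.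
Proof.
move=> w0 w1 XY x.
have -> : Y - \sum_i w i *: X i = \sum_i w i *: (Y - X i).
  by under [RHS]eq_bigr do rewrite scalerBr; rewrite sumrB -scaler_suml w1 scale1r.
rewrite mulmx_sumr mulmx_suml summxE; apply: sumr_ge0 => i _.
by rewrite -scalemxAr -scalemxAl mxE mulr_ge0 ?XY.
Qed.

Lemma convex_sum_itv w (k : 'I_m -> R) (a c : R) :
  (forall i, 0 <= w i) -> \sum_i w i = 1 -> (forall i, a <= k i <= c) ->
  a <= \sum_i w i * k i <= c.
Proof.
move=> w0 w1 ak.
rewrite -[a]mul1r -[c]mul1r -w1 !mulr_suml.
by apply/andP; split; apply: ler_sum => i _; apply: ler_wpM2l => //;
  case/andP: (ak i).
Qed.

End convex_combination.

Theorem theorem2 (R : realType) (N p m : nat) (hN : (0 < N)%N)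
  (lo hi : 'rV[R]_p) (hlohi : forall j, lo 0 j <= hi 0 j)
  (F : 'rV[R]_p -> 'rV[R]_N.+1)
  (L : set 'rV[R]_N.+1) (hL : L = F @` hyper_rectangle lo hi)
  (hLbounded : bounded_set L) (hLconnected : connected L)
  (bl bu : R) (hb : b_entries_in L bl bu)
  (AB : R -> 'rV[R]_N.+1) (hAB : forall t : R, L (AB t))
  (V : 'I_m -> 'rV[R]_N.+1) (hV : polytope_vertices V)
  (hVsign : vertex_sign V bl bu)
  (hLV : L `<=` conv_hull V)
  (km kM : R) (hkm : 0 < km) (hkM : km < kM)
  (hopt : (optimal_value V km kM < 0)%E) :
  condition_C1 L km kM.
Proof.
(* An infimum below 0 yields a feasible [s < 0] without any minimizer; [- s] then serves as
   [sigma]. *)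
move: hopt => /ereal_inf_lt[_ [s [P [K [lyap Kitv Ppos]]] <-]].
rewrite lte_fin => s_lt0.
exists P, (- s); split => //; first by rewrite oppr_gt0.
move=> v Lv; have [w [w0 w1 vE]] := hLV _ Lv.
have [_ bsign /(_ _ Lv)/andP[blv bvu]] := hb.
have bv_neq0 : bcoef v != 0.
  case: bsign => [bl0|bu0].
  - by rewrite gt_eqF// (lt_le_trans bl0).
  - by rewrite lt_eqF// (le_lt_trans bvu).
pose u i := w i * (bcoef (V i) / bcoef v).
have u0 i : 0 <= u i.
  apply: mulr_ge0 => //; case: bsign => [bl0|bu0].
  - by rewrite divr_ge0 ?hVsign.1// ltW// (lt_le_trans bl0).
  - by rewrite mulr_le0 ?hVsign.2// invr_le0 ltW// (le_lt_trans bvu).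
(* The numerators [w i * bcoef (V i)] add up to the b-entry of [v] itself. *)
have u1 : \sum_i u i = 1.
  under eq_bigr do rewrite /u mulrA.
  by rewrite -mulr_suml -bcoef_sum -vE divff.
exists (\sum_i u i * K i); split; first exact: convex_sum_itv.
rewrite opprK vE (lyapunov_form_convex _ _ K).
  exact: mxpreceq_convex.
apply: closed_loop_convex => //.
(* Multiplying the gain by [bcoef v] cancels the denominators in [u]. *)
rewrite -vE mulr_sumr; apply: eq_bigr => i _.
by rewrite mulrA mulrCA (mulrC (bcoef v)) divfK// mulrA.
Qed.
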